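(* Let $k \geq 2$ be an integer and let $R$ be a finite commutative ring, where $R \cong R_{1} \oplus \dots \oplus R_{t}$ is the decomposition of $R$ into finite local commutative rings $R_{1}, \dots, R_{t}$. Then for any $c \in H(R)$ we have $$\varphi_{k}(H(R), c)=\prod_{i=1}^{t}\varphi_{k}(H(R_{i}), c_{i}),$$ where $\psi : H(R) \rightarrow H(R_{1}) \oplus \dots \oplus H(R_{t})$ is the ring isomorphism induced coefficientwise by the isomorphism $R \cong R_1\oplus\dots\oplus R_t$, and $\psi(c)=(c_{1}, \dots, c_{t})$.
   Context: All rings are associative with identity. For a ring $S$, $S^{*}$ denotes its group of units, and $u\in S$ is an exceptional unit if $u\in S^*$ and $1-u\in S^*$; $S^{**}$ is the set of exceptional units of $S$. For an integer $k\ge 2$ and $c\in S$, $\varphi_k(S,c)=|\{(x_1,\dots,x_k)\in (S^{**})^k : x_1+\dots+x_k=c\}|$. For a commutative ring $R$, the quaternion ring is $H(R)=R\oplus R\mathbf{i}\oplus R\mathbf{j}\oplus R\mathbf{k}$ with componentwise addition and multiplication determined by $\mathbf{i}^2=\mathbf{j}^2=\mathbf{k}^2=\mathbf{i}\mathbf{j}\mathbf{k}=-1$, $\mathbf{i}\mathbf{j}=-\mathbf{j}\mathbf{i}$, where $\mathbf{i},\mathbf{j},\mathbf{k}$ commute with the elements of $R$. *)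

(* Defs.v *)
From HB Require Import structures.
From mathcomp Require Import all_boot all_fingroup all_algebra.
From mathcomp Require Import ring.

Set Implicit Arguments.
Unset Strict Implicit.
Unset Printing Implicit Defensive.

Import GRing.Theory.

Local Open Scope ring_scope.

(* [Quat a b c d] stands for a + b i + c j + d k. *)
Record quat (R : Type) := Quat { quat1 : R; quati : R; quatj : R; quatk : R }.

Definition tuple_of_quat (R : Type) (x : quat R) : R * R * R * R :=
  (quat1 x, quati x, quatj x, quatk x).

Definition quat_of_tuple (R : Type) (x : R * R * R * R) : quat R :=
  let: (a, b, c, d) := x in Quat a b c d.

Lemma tuple_of_quatK (R : Type) : cancel (@tuple_of_quat R) (@quat_of_tuple R).
Proof. by case. Qed.

HB.instance Definition _ (R : eqType) :=
  Equality.copy (quat R) (can_type (@tuple_of_quatK R)).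
HB.instance Definition _ (R : choiceType) :=
  Choice.copy (quat R) (can_type (@tuple_of_quatK R)).
HB.instance Definition _ (R : countType) :=
  Countable.copy (quat R) (can_type (@tuple_of_quatK R)).
HB.instance Definition _ (R : finType) :=
  Finite.copy (quat R) (can_type (@tuple_of_quatK R)).

Section QuatRing.

Variable R : comPzRingType.
Implicit Types x y z : quat R.

Definition quat_zero : quat R := Quat 0 0 0 0.
Definition quat_one : quat R := Quat 1 0 0 0.

Definition quat_opp x :=
  Quat (- quat1 x) (- quati x) (- quatj x) (- quatk x).

Definition quat_add x y :=
  Quat (quat1 x + quat1 y) (quati x + quati y)
       (quatj x + quatj y) (quatk x + quatk y).

Definition quat_mul x y :=
  let: Quat a b c d := x in
  let: Quat a' b' c' d' := y in
  Quat (a * a' - b * b' - c * c' - d * d')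
       (a * b' + b * a' + c * d' - d * c')
       (a * c' - b * d' + c * a' + d * b')
       (a * d' + b * c' - c * b' + d * a').

Fact quat_addA : associative quat_add.
Proof. by move=> x y z; congr Quat; apply: addrA. Qed.

Fact quat_addC : commutative quat_add.
Proof. by move=> x y; congr Quat; apply: addrC. Qed.

Fact quat_add0 : left_id quat_zero quat_add.
Proof. by case=> a b c d; congr Quat; apply: add0r. Qed.

Fact quat_addN : left_inverse quat_zero quat_opp quat_add.
Proof. by move=> x; congr Quat; apply: addNr. Qed.

Fact quat_mulA : associative quat_mul.
Proof.
by move=> [a b c d] [a' b' c' d'] [a'' b'' c'' d'']; congr Quat; ring.
Qed.

Fact quat_mul1q : left_id quat_one quat_mul.
Proof. by move=> [a b c d]; congr Quat; ring. Qed.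

Fact quat_mulq1 : right_id quat_one quat_mul.
Proof. by move=> [a b c d]; congr Quat; ring. Qed.

Fact quat_mulDl : left_distributive quat_mul quat_add.
Proof.
by move=> [a b c d] [a' b' c' d'] [a'' b'' c'' d'']; congr Quat => /=; ring.
Qed.

Fact quat_mulDr : right_distributive quat_mul quat_add.
Proof.
by move=> [a b c d] [a' b' c' d'] [a'' b'' c'' d'']; congr Quat => /=; ring.
Qed.

HB.instance Definition _ := GRing.isZmodule.Build (quat R)
  quat_addA quat_addC quat_add0 quat_addN.

HB.instance Definition _ := GRing.Zmodule_isPzRing.Build (quat R)
  quat_mulA quat_mul1q quat_mulq1 quat_mulDl quat_mulDr.

End QuatRing.

HB.instance Definition _ (R : finComPzRingType) := Finite.on (quat R).

Section QuatRelations.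

Variable R : comPzRingType.

Definition quat_const (a : R) : quat R := Quat a 0 0 0.
Definition qi : quat R := Quat 0 1 0 0.
Definition qj : quat R := Quat 0 0 1 0.
Definition qk : quat R := Quat 0 0 0 1.

Lemma quatE (a b c d : R) :
  Quat a b c d = quat_const a + quat_const b * qi
                 + quat_const c * qj + quat_const d * qk.
Proof. by congr Quat => /=; ring. Qed.

Lemma quat_relations :
  [/\ qi * qi = -1, qj * qj = -1, qk * qk = -1, qi * qj * qk = -1
    & qi * qj = - (qj * qi)].
Proof. by split; congr Quat => /=; ring. Qed.

Lemma quat_const_central (a : R) (x : quat R) :
  quat_const a * x = x * quat_const a.
Proof. by case: x => b c d e; congr Quat => /=; ring. Qed.

End QuatRelations.

Section QuatMap.

Definition quat_map (R S : Type) (f : R -> S) (x : quat R) : quat S :=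
  Quat (f (quat1 x)) (f (quati x)) (f (quatj x)) (f (quatk x)).

Variables (R S : comPzRingType) (f : {rmorphism R -> S}).

Fact quat_map_is_zmod_morphism : zmod_morphism (quat_map f).
Proof. by move=> x y; congr Quat; apply: rmorphB. Qed.

Fact quat_map_is_monoid_morphism : monoid_morphism (quat_map f).
Proof.
split=> [|[a b c d] [a' b' c' d']]; congr Quat => /=;
  by rewrite ?rmorph0 ?rmorph1 // !(rmorphB, rmorphD, rmorphM).
Qed.

HB.instance Definition _ := GRing.isZmodMorphism.Build (quat R) (quat S)
  (quat_map f) quat_map_is_zmod_morphism.
HB.instance Definition _ := GRing.isMonoidMorphism.Build (quat R) (quat S)
  (quat_map f) quat_map_is_monoid_morphism.

End QuatMap.

(* The direct sum of a finite family of rings, as the dependent product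
   {dffun forall i, R_ i} with pointwise operations. *)
Section DirectSum.

Variables (I : finType) (R_ : I -> pzRingType).

Local Notation prodR := {dffun forall i : I, R_ i}.
Implicit Types x y z : prodR.

Definition dffun_zero : prodR := [ffun i => 0 : R_ i].
Definition dffun_opp x : prodR := [ffun i => - x i].
Definition dffun_add x y : prodR := [ffun i => x i + y i].
Definition dffun_one : prodR := [ffun i => 1 : R_ i].
Definition dffun_mul x y : prodR := [ffun i => x i * y i].

Fact dffun_addA : associative dffun_add.
Proof. by move=> x y z; apply/ffunP=> i; rewrite !ffunE addrA. Qed.

Fact dffun_addC : commutative dffun_add.
Proof. by move=> x y; apply/ffunP=> i; rewrite !ffunE addrC. Qed.

Fact dffun_add0 : left_id dffun_zero dffun_add.
Proof. by move=> x; apply/ffunP=> i; rewrite !ffunE add0r. Qed.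

Fact dffun_addN : left_inverse dffun_zero dffun_opp dffun_add.
Proof. by move=> x; apply/ffunP=> i; rewrite !ffunE addNr. Qed.

Fact dffun_mulA : associative dffun_mul.
Proof. by move=> x y z; apply/ffunP=> i; rewrite !ffunE mulrA. Qed.

Fact dffun_mul1x : left_id dffun_one dffun_mul.
Proof. by move=> x; apply/ffunP=> i; rewrite !ffunE mul1r. Qed.

Fact dffun_mulx1 : right_id dffun_one dffun_mul.
Proof. by move=> x; apply/ffunP=> i; rewrite !ffunE mulr1. Qed.

Fact dffun_mulDl : left_distributive dffun_mul dffun_add.
Proof. by move=> x y z; apply/ffunP=> i; rewrite !ffunE mulrDl. Qed.

Fact dffun_mulDr : right_distributive dffun_mul dffun_add.
Proof. by move=> x y z; apply/ffunP=> i; rewrite !ffunE mulrDr. Qed.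

HB.instance Definition _ := GRing.isZmodule.Build prodR
  dffun_addA dffun_addC dffun_add0 dffun_addN.

HB.instance Definition _ := GRing.Zmodule_isPzRing.Build prodR
  dffun_mulA dffun_mul1x dffun_mulx1 dffun_mulDl dffun_mulDr.

End DirectSum.

Section QuatDirectSum.

Variables (I : finType) (R : comPzRingType) (R_ : I -> comPzRingType).

(* The map H(R) -> \bigoplus_i H(R_i) induced coefficientwise by a map
   f : R -> \bigoplus_i R_i. *)
Definition quat_dsum (f : R -> {dffun forall i : I, R_ i}) (x : quat R) :
    {dffun forall i : I, quat (R_ i)} :=
  [ffun i => quat_map (fun r => f r i) x].

Variable f : {rmorphism R -> {dffun forall i : I, R_ i}}.

Fact quat_dsum_is_zmod_morphism : zmod_morphism (quat_dsum f).
Proof.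
by move=> x y; apply/ffunP=> i; rewrite !ffunE; congr Quat;
  rewrite rmorphB !ffunE.
Qed.

Fact quat_dsum_is_monoid_morphism : monoid_morphism (quat_dsum f).
Proof.
split=> [|[a b c d] [a' b' c' d']]; apply/ffunP=> i; rewrite !ffunE;
  congr Quat => /=;
  by rewrite ?rmorph0 ?rmorph1 ?(rmorphB, rmorphD, rmorphM) !ffunE.
Qed.

HB.instance Definition _ := GRing.isZmodMorphism.Build
  (quat R) {dffun forall i : I, quat (R_ i)}
  (quat_dsum f) quat_dsum_is_zmod_morphism.
HB.instance Definition _ := GRing.isMonoidMorphism.Build
  (quat R) {dffun forall i : I, quat (R_ i)}
  (quat_dsum f) quat_dsum_is_monoid_morphism.

Lemma quat_dsum_bij : bijective f -> bijective (quat_dsum f).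
Proof.
move=> [g fK gK].
pose h (P : forall i, quat (R_ i) -> R_ i)
  (y : {dffun forall i : I, quat (R_ i)}) : R :=
  g [ffun i => P i (y i)].
exists (fun y => Quat (h (fun=> @quat1 _) y) (h (fun=> @quati _) y)
                      (h (fun=> @quatj _) y) (h (fun=> @quatk _) y)).
  move=> [a b c d]; congr Quat; rewrite -[RHS]fK /h; congr g;
  by apply/ffunP=> i; rewrite !ffunE.
move=> y; apply/ffunP=> i; rewrite ffunE /h /quat_map /= !gK !ffunE.
by case: (y i).
Qed.

End QuatDirectSum.

(* Two-sided units are defined for rings that may be trivial, where the
   library's GRing.unit is not available; see ring_unitsE. *)
Definition ring_units (S : finPzRingType) : {set S} :=
  [set u | [exists v, (u * v == 1) && (v * u == 1)]].

Lemma ring_unitsE (S : finUnitRingType) :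
  ring_units S = [set u | u \is a GRing.unit].
Proof.
apply/setP=> u; rewrite !inE; apply/existsP/unitrP => [[v]|[v []]].
  by case/andP=> /eqP uv /eqP vu; exists v.
by move=> vu uv; exists v; rewrite uv vu !eqxx.
Qed.

Definition exceptional_units (S : finPzRingType) : {set S} :=
  [set u | (u \in ring_units S) && (1 - u \in ring_units S)].

Definition phi (k : nat) (S : finPzRingType) (c : S) : nat :=
  #|[set x : {ffun 'I_k -> S} |
      [forall i, x i \in exceptional_units S] && (\sum_i x i == c)]|.

(* idealr_closed includes the requirement that the ideal be proper. *)
Definition maximal_ideal (R : finComNzRingType) (M : {set R}) : Prop :=
  idealr_closed M /\
  forall J : {set R}, idealr_closed J -> M \subset J -> J = M.

Definition local_ring (R : finComNzRingType) : Prop :=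
  exists! M : {set R}, maximal_ideal M.

(* Main.v *)
(* Quaternions play no role beyond [quat_dsum_bij]: in a direct sum of rings,
   being an exceptional unit and summing to a given element are both
   componentwise conditions, so the solution set is the Cartesian product of
   the solution sets of the components. *)
Require Import Defs.
From mathcomp Require Import all_boot all_algebra.

Set Implicit Arguments.
Unset Strict Implicit.
Unset Printing Implicit Defensive.

Import GRing.Theory.

Local Open Scope ring_scope.

Section PhiDirectSum.

Variables (S : finPzRingType) (I : finType) (S_ : I -> finPzRingType).
Variables (g : {rmorphism S -> {dffun forall i : I, S_ i}}).
Hypothesis g_bij : bijective g.

(** Multiplication in the direct sum is componentwise, so inverses chosen in each component assemble
    into an inverse of [g u], which the inverse [h] of [g] carries back to [S]. *)
Lemma ring_units_dsum (u : S) :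
  (u \in ring_units S) = [forall i, g u i \in ring_units (S_ i)].
Proof.
have [h gK hK] := g_bij; rewrite inE; apply/existsP/forallP => [[v]|unit_u].
  case/andP=> /eqP uv /eqP vu i; rewrite inE; apply/existsP; exists (g v i).
  move/(congr1 g)/ffunP/(_ i): uv; move/(congr1 g)/ffunP/(_ i): vu.
  by rewrite !rmorphM !rmorph1 !ffunE => -> ->; rewrite eqxx.
have inv_u i : exists w, (g u i * w == 1) && (w * g u i == 1).
  by apply/existsP; move: (unit_u i); rewrite inE.
pose w : {dffun forall i : I, S_ i} := [ffun i => xchoose (inv_u i)].
exists (h w); rewrite -!(inj_eq (can_inj gK)) !rmorphM !rmorph1 hK.
by apply/andP; split; apply/eqP/ffunP=> i; rewrite !ffunE;
  have /andP[/eqP ? /eqP ?] := xchooseP (inv_u i).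
Qed.

Lemma exceptional_units_dsum (u : S) :
  (u \in exceptional_units S)
    = [forall i, g u i \in exceptional_units (S_ i)].
Proof.
rewrite inE !ring_units_dsum.
have g1B i : g (1 - u) i = 1 - g u i by rewrite rmorphB rmorph1 !ffunE.
apply/andP/forallP=> [[/forallP uu /forallP u1] i|eu].
  by rewrite inE uu -g1B u1.
by split; apply/forallP=> i; move: (eu i); rewrite inE -g1B => /andP[].
Qed.

Lemma phi_dsum (k : nat) (c : S) : phi k c = (\prod_i phi k (g c i))%N.
Proof.
have [h gK hK] := g_bij.
(* Besides applying [g], [G] transposes: a [k]-tuple of families becomes a family of [k]-tuples. [H]
   transposes back and applies [h]. *)
pose G (x : {ffun 'I_k -> S}) : {dffun forall i, {ffun 'I_k -> S_ i}} :=
  [ffun i => [ffun j => g (x j) i]].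
pose H (y : {dffun forall i, {ffun 'I_k -> S_ i}}) : {ffun 'I_k -> S} :=
  [ffun j => h [ffun i => y i j]].
have GK : cancel G H.
  move=> x; apply/ffunP=> j; rewrite ffunE -[RHS]gK; congr h.
  by apply/ffunP=> i; rewrite !ffunE.
have HK : cancel H G.
  by move=> y; apply/ffunP=> i; apply/ffunP=> j; rewrite !ffunE hK ffunE.
(* Evaluation at [i] is additive, so it commutes with the sum. *)
have g_sum (x : {ffun 'I_k -> S}) i : g (\sum_j x j) i = \sum_j G x i j.
  rewrite rmorph_sum (big_morph (fun y : {dffun forall i, S_ i} => y i)
    (id1 := 0) (op1 := +%R)) => [|y z|]; rewrite ?ffunE //.
  by apply: eq_bigr => j _; rewrite !ffunE.
pose sols i := [set y : {ffun 'I_k -> S_ i} |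
  [forall j, y j \in exceptional_units (S_ i)] && (\sum_j y j == g c i)].
transitivity
  #|(family sols : simpl_pred {dffun forall i, {ffun 'I_k -> S_ i}})|.
  (* The solutions in [S] are counted by their preimage under the bijection [H], which is then
     compared with [family sols] pointwise. *)
  apply: etrans (esym (on_card_preimset (onW_bij _ (Bijective HK GK)))) _.
  apply: eq_card => y.
  rewrite !inE; set x := H y; have -> : y = G x by rewrite HK.
  apply/andP/familyP=> [[/forallP xE /eqP xc] i|ys].
    rewrite inE -g_sum xc eqxx andbT; apply/forallP=> j.
    by move: (xE j); rewrite exceptional_units_dsum !ffunE => /forallP/(_ i).
  split.
    apply/forallP=> j; rewrite exceptional_units_dsum; apply/forallP=> i.
    by move: (ys i); rewrite inE => /andP[/forallP/(_ j)]; rewrite !ffunE.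
  (* Injectivity of [g] lets the sum condition be checked in each component. *)
  rewrite -(inj_eq (can_inj gK)); apply/eqP/ffunP=> i.
  by move: (ys i); rewrite inE -g_sum => /andP[_ /eqP].
by rewrite card_family foldrE big_map big_enum.
Qed.

End PhiDirectSum.

Theorem theorem2p5 (k : nat) (k_ge2 : (2 <= k)%N)
    (R : finComPzRingType) (t : nat) (R_ : 'I_t -> finComNzRingType)
    (R_local : forall i, local_ring (R_ i))
    (f : {rmorphism R -> {dffun forall i, R_ i}}) (f_bij : bijective f)
    (c : quat R) :
  phi k c = (\prod_(i < t) phi k (quat_dsum f c i))%N.
Proof. exact: (phi_dsum (quat_dsum_bij f_bij)). Qed.
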